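(* Let $\mathbf{I} = (X,f,x_0)$ be a Peano iterator. Then there exists a unique total order $\le$ on $X$ compatible with $\mathbf{I}$ and the following hold: (1) $x_0 \le x$ and $x < f(x)$ for all $x \in X$, where $y < x$ means $y \le x$ but $y \ne x$. (2) If $y \le x$ then $f(y) \le f(x)$. (3) Let $x, y \in X$. Then $y \le f(x)$ if and only if $y \le x$ or $y = f(x)$. Thus $y < f(x)$ if and only if $y \le x$. (4) For each $x \in X$ let $L_x = \{ y \in X : y < x \}$. Then $L_{x_0} = \varnothing$ and $L_{f(x)}$ is the disjoint union of $L_x$ and the singleton set $\{x\}$ for each $x \in X$. Moreover, $L_{f(x)}$ is also the disjoint union of $\{x_0\}$ and $f(L_x)$ for each $x \in X$. (5) The subclass $L_x$ is a finite set for each $x \in X$. (6) Each non-empty subclass $Y$ of $X$ contains a minimum element, i.e., an element $x$ with $x \le y$ for all $y \in Y$.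
   Context: A set $E$ is finite if $\mathcal{P}(E)$ is the only subset $\mathcal{S}$ of the power set $\mathcal{P}(E)$ such that $\varnothing \in \mathcal{S}$ and $F \cup \{e\} \in \mathcal{S}$ whenever $F \in \mathcal{S}$, $F \neq E$ and $e \in E \setminus F$ (this is equivalent to the usual notion of finiteness). An iterator is a triple $\mathbf{I} = (X,f,x_0)$ with $X$ a class (a set or a proper class), $f : X \to X$ a mapping and $x_0$ an element of $X$. A subclass $Y$ of $X$ is $f$-invariant if $f(y) \in Y$ for all $y \in Y$. $\mathbf{I}$ is a Peano iterator if the only $f$-invariant subclass of $X$ containing $x_0$ is $X$ itself, $f$ is injective and $x_0 \notin f(X)$. A total order $\le$ on $X$ is compatible with $\mathbf{I}$ if $x \le f(x)$ for all $x \in X$. *)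

(* Defs.v *)
From Corelib Require Relation_Definitions.
From mathcomp Require Import all_boot classical_sets.

Set Implicit Arguments.
Unset Strict Implicit.
Unset Printing Implicit Defensive.

Local Open Scope classical_set_scope.

(* A class is a type [X : Type] and a subclass of it is a [set X]. *)

(* The collections quantified over consist of subsets of [E], so [E] need not
   be the whole carrier type. *)
Definition finite {X : Type} (E : set X) : Prop :=
  forall S : set (set X),
    S `<=` [set F | F `<=` E] ->
    S set0 ->
    (forall (F : set X) (e : X),
        S F -> F <> E -> (E `\` F) e -> S (F `|` [set e])) ->
    S = [set F | F `<=` E].

Definition invariant_class {X : Type} (f : X -> X) (Y : set X) : Prop :=
  forall y, Y y -> Y (f y).

Record peano_iterator {X : Type} (f : X -> X) (x0 : X) : Prop := PeanoIterator {
  peano_minimal :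
    forall Y : set X, invariant_class f Y -> Y x0 -> Y = [set: X];
  peano_injective : injective f;
  peano_base : ~ range f x0
}.

Definition total_order {X : Type} (le : X -> X -> Prop) : Prop :=
  Relation_Definitions.order X le /\ forall x y, le x y \/ le y x.

Definition compatible {X : Type} (f : X -> X) (le : X -> X -> Prop) : Prop :=
  forall x, le x (f x).

Definition strict {X : Type} (le : X -> X -> Prop) (y x : X) : Prop :=
  le y x /\ y <> x.

Definition initial_segment {X : Type} (le : X -> X -> Prop) (x : X) : set X :=
  [set y | strict le y x].

Definition disjoint_union {X : Type} (C A B : set X) : Prop :=
  C = A `|` B /\ A `&` B = set0.

(* Main.v *)
Require Import Defs.
From mathcomp Require Import all_boot classical_sets.
From mathcomp Require Import boolp.

Local Open Scope classical_set_scope.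

(** The order is forced to be reachability: [reach f y x] holds when [x] is some
    iterate of [y] under [f].  Any compatible order contains reachability, by
    transitivity along the orbit.  When reachability is itself total, a
    compatible order cannot contain more: a further pair [le y x] would come with
    [reach f x y], hence [le x y], and antisymmetry would give [y = x].  This is
    uniqueness.

    Peano induction writes every element as an iterate of [x0], so any two
    elements are comparable ([reach_total]); together with injectivity it also
    excludes periodic points ([iter_aperiodic]), so reachability is
    antisymmetric ([reach_antisym]).  The arithmetic clauses then come from
    looking at the first or the last application of [f] in an iterate
    ([reach_succ_strict], [reachSr]).  Finiteness of the initial segments follows
    by Peano induction, because each segment gains one point at a time and
    adjoining a point preserves finiteness ([finite_setU1]).  For minima: if [Y]
    had none, its class of lower bounds would contain [x0] and be invariant, so
    an element of [Y] would be a lower bound, hence a minimum after all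
    ([reach_min]). *)

(** * Finite sets *)

Lemma finite_set0 (X : Type) : finite (@set0 X).
Proof.
move=> S Ssub S0 _; apply/seteqP; split=> // F /= F0.
by have -> : F = set0 by apply/seteqP; split.
Qed.

(** The subsets [F] of [E] for which both [F] and [F] with [a] adjoined lie in
    [S] form a collection to which the finiteness of [E] applies; those two kinds
    of sets exhaust the subsets of [E] with [a] adjoined. *)
Lemma finite_setU1 {X : Type} {E : set X} {a : X} :
  ~ E a -> finite E -> finite (E `|` [set a]).
Proof.
move=> nEa finE S Ssub S0 SU.
pose T : set (set X) := [set F | [/\ F `<=` E, S F & S (F `|` [set a])]].
have neqEa F : ~ F a -> F <> E `|` [set a].
  by move=> nFa eF; apply: nFa; rewrite eF; right.
have TE : T = [set F | F `<=` E].
  apply: finE.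
  - by move=> F [].
  - split=> //; apply: SU => //; first exact: neqEa.
    by split=> //; right.
  - move=> F e [FE SF SFa] _ [Ee nFe].
    split.
    + by move=> x [/FE|->].
    + by apply: SU => //; [apply: neqEa => /FE | split; [left|]].
    + rewrite setUAC; apply: SU => //.
        move=> eF; have : (E `|` [set a]) e by left.
        by rewrite -eF => -[//|ea]; apply: nEa; rewrite -ea.
      by split; [left | case=> // ea; apply: nEa; rewrite -ea].
apply/seteqP; split=> // F /= FEa.
have TFa : T (F `\ a).
  by rewrite TE => x [/FEa [//|xa] nxa].
case: TFa => _ SF SFa.
have [Fa|nFa] := pselect (F a).
  suff <- : F `\ a `|` [set a] = F by [].
  apply/seteqP; split=> x; first by case=> [[]|->].
  by move=> Fx; have [->|xa] := pselect (x = a); [right | left; split].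
suff <- : F `\ a = F by [].
apply/seteqP; split=> x; first by case.
by move=> Fx; split=> // xa; apply: nFa; rewrite -xa.
Qed.

(** * Reachability under iteration *)

Definition reach {X : Type} (f : X -> X) (y x : X) : Prop :=
  exists n, iter n f y = x.

Lemma reach_refl {X : Type} (f : X -> X) (x : X) : reach f x x.
Proof. by exists 0. Qed.

Lemma reach_trans {X : Type} {f : X -> X} {x y z : X} :
  reach f x y -> reach f y z -> reach f x z.
Proof. by move=> [m <-] [n <-]; exists (n + m); rewrite iterD. Qed.

Lemma reach_next {X : Type} (f : X -> X) (x : X) : reach f x (f x).
Proof. by exists 1. Qed.

Lemma reach_mono {X : Type} {f : X -> X} {x y : X} :
  reach f y x -> reach f (f y) (f x).
Proof. by move=> [n <-]; exists n; rewrite -iterSr. Qed.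

(** A strict step applies [f] at least once, and the first application can be
    split off. *)
Lemma reach_succ_strict {X : Type} {f : X -> X} {x y : X} :
  strict (reach f) x y -> reach f (f x) y.
Proof.
move=> [[[|n] eq_y] neq]; first by case: neq.
by exists n; rewrite -iterSr.
Qed.

(** Injectivity cancels the last application of [f]. *)
Lemma reachSr {X : Type} {f : X -> X} {x y : X} :
  injective f -> reach f y (f x) <-> reach f y x \/ y = f x.
Proof.
move=> finj; split=> [[[|n] /= eqfx]|[yx|->]]; last exact: reach_refl.
- by right.
- by left; exists n; apply: finj.
- exact: reach_trans yx (reach_next f x).
Qed.

Lemma compatible_reach {X : Type} {f : X -> X} {le : X -> X -> Prop} {x y : X} :
  total_order le -> compatible f le -> reach f y x -> le y x.
Proof.
move=> [[le_refl le_trans _] _] lef [n <-].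
by elim: n => [|n IHn] /=; [exact: le_refl | exact: le_trans IHn (lef _)].
Qed.

(** * Peano iterators *)

Lemma peano_ind {X : Type} {f : X -> X} {x0 : X} {P : X -> Prop} :
  peano_iterator f x0 -> P x0 -> (forall x, P x -> P (f x)) -> forall x, P x.
Proof.
by move=> hI P0 PS x; have -> : P = setT by exact: peano_minimal hI P PS P0.
Qed.

Lemma peano_base_neq {X : Type} {f : X -> X} {x0 : X} :
  peano_iterator f x0 -> forall x, f x <> x0.
Proof. by move=> hI x fx; apply: (peano_base hI); exists x. Qed.

Lemma peano_case {X : Type} {f : X -> X} {x0 : X} :
  peano_iterator f x0 -> forall x, x = x0 \/ exists y, x = f y.
Proof.
by move=> hI; apply: (peano_ind hI) => [|x _]; [left | right; exists x].
Qed.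

Lemma reach_base {X : Type} {f : X -> X} {x0 : X} :
  peano_iterator f x0 -> forall x, reach f x0 x.
Proof.
move=> hI; apply: (peano_ind hI) => [|x x0x]; first exact: reach_refl.
exact: reach_trans x0x (reach_next f x).
Qed.

(** A period of [f x] is a period of [x] by injectivity, so periods descend to
    [x0], which is not in the range of [f]. *)
Lemma iter_aperiodic {X : Type} {f : X -> X} {x0 : X} (n : nat) :
  peano_iterator f x0 -> forall x, iter n.+1 f x <> x.
Proof.
move=> hI; apply: (peano_ind hI) => [|x nx]; first exact: peano_base_neq hI _.
by rewrite -iterSr iterS => /(peano_injective hI).
Qed.

Lemma reach_antisym {X : Type} {f : X -> X} {x0 : X} :
  peano_iterator f x0 -> forall x y, reach f x y -> reach f y x -> x = y.
Proof.
move=> hI x y [m <-] [[|n]] //=.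
by rewrite -iterS -iterD addSn => /(iter_aperiodic _ hI).
Qed.

Lemma reach_total {X : Type} {f : X -> X} {x0 : X} :
  peano_iterator f x0 -> forall x y, reach f x y \/ reach f y x.
Proof.
move=> hI x y.
have [[m <-] [n <-]] := (reach_base hI x, reach_base hI y).
have [le_mn|/ltnW le_nm] := leqP m n; [left|right].
  by exists (n - m); rewrite -iterD subnK.
by exists (m - n); rewrite -iterD subnK.
Qed.

Lemma reach_total_order {X : Type} {f : X -> X} {x0 : X} :
  peano_iterator f x0 -> total_order (reach f).
Proof.
move=> hI; split; last exact: reach_total hI.
split; [exact: reach_refl | by move=> x y z; exact: reach_trans |].
exact: reach_antisym hI.
Qed.

Lemma reach_unique {X : Type} {f : X -> X} {x0 : X} {le : X -> X -> Prop} :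
  peano_iterator f x0 -> total_order le -> compatible f le -> reach f = le.
Proof.
move=> hI le_order le_f; apply/funext => y; apply/funext => x; apply/propext.
have reach_le u v : reach f u v -> le u v.
  exact: compatible_reach le_order le_f.
split=> [|le_yx]; first exact: reach_le.
have [//|xy] := reach_total hI y x.
case: le_order => -[_ _ le_anti] _.
by rewrite (le_anti _ _ le_yx (reach_le _ _ xy)); exact: reach_refl.
Qed.

Lemma strict_reach_next {X : Type} {f : X -> X} {x0 : X} :
  peano_iterator f x0 -> forall x, strict (reach f) x (f x).
Proof.
move=> hI x; split; first exact: reach_next.
by move=> xfx; apply: (iter_aperiodic 0 hI x).
Qed.

Lemma strict_reachSr {X : Type} {f : X -> X} {x0 : X} :
  peano_iterator f x0 ->
  forall x y, strict (reach f) y (f x) <-> reach f y x.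
Proof.
move=> hI x y; split=> [[/(reachSr (peano_injective hI)) [//|//]]|yx].
split=> [|yfx]; first exact: reach_trans yx (reach_next f x).
rewrite yfx in yx; have [xfx nxfx] := strict_reach_next hI x.
exact/nxfx/(reach_antisym hI).
Qed.

Lemma initial_segment_base {X : Type} {f : X -> X} {x0 : X} :
  peano_iterator f x0 -> initial_segment (reach f) x0 = set0.
Proof.
move=> hI; apply/seteqP; split=> // y [yx0 neq]; apply: neq.
exact: reach_antisym hI _ _ yx0 (reach_base hI y).
Qed.

Lemma initial_segment_next {X : Type} {f : X -> X} {x0 : X} :
  peano_iterator f x0 -> forall x,
  disjoint_union (initial_segment (reach f) (f x))
    (initial_segment (reach f) x) [set x].
Proof.
move=> hI x; split; last by apply/seteqP; split=> // y [[_ neq]].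
apply/seteqP; split=> y /=.
  move=> /(strict_reachSr hI) yx.
  by have [->|neq] := pselect (y = x); [right | left; split].
by case=> [[yx _]|->]; apply/(strict_reachSr hI) => //; exact: reach_refl.
Qed.

(** An element other than [x0] is a successor [f z], and [f z] lies strictly
    below [f x] exactly when [z] lies strictly below [x]. *)
Lemma initial_segment_next_image {X : Type} {f : X -> X} {x0 : X} :
  peano_iterator f x0 -> forall x,
  disjoint_union (initial_segment (reach f) (f x))
    [set x0] (f @` initial_segment (reach f) x).
Proof.
move=> hI x; split; last first.
  by apply/seteqP; split=> // y [-> [z _ /(peano_base_neq hI)]].
apply/seteqP; split=> y /=.
  have [->|[z ->]] := peano_case hI y; first by left.
  move=> /(strict_reachSr hI) fzx; right; exists z => //.
  split; first exact: reach_trans (reach_next f z) fzx.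
  move=> zx; rewrite -zx in fzx.
  have [zfz nzfz] := strict_reach_next hI z.
  exact/nzfz/(reach_antisym hI).
case=> [->|[z [zx neq] <-]].
  exact/(strict_reachSr hI)/(reach_base hI).
by split; [exact: reach_mono | move=> /(peano_injective hI)].
Qed.

Lemma finite_initial_segment {X : Type} {f : X -> X} {x0 : X} :
  peano_iterator f x0 -> forall x, finite (initial_segment (reach f) x).
Proof.
move=> hI; apply: (peano_ind hI) => [|x finx].
  by rewrite (initial_segment_base hI); exact: finite_set0.
have [-> _] := initial_segment_next hI x.
by apply: finite_setU1 => // -[_].
Qed.

(** Without a minimum, a lower bound [x] of [Y] lies outside [Y], so it is
    strictly below all of [Y] and [f x] is again a lower bound. *)
Lemma reach_min {X : Type} {f : X -> X} {x0 : X} {Y : set X} :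
  peano_iterator f x0 -> Y !=set0 ->
  exists x, Y x /\ forall y, Y y -> reach f x y.
Proof.
move=> hI [y0 Yy0]; apply: contrapT => nomin.
have lower_bound : forall x y, Y y -> reach f x y.
  apply: (peano_ind hI) => [y _|x lbx y Yy]; first exact: reach_base hI y.
  apply: reach_succ_strict; split; first exact: lbx.
  by move=> xy; apply: nomin; exists x; rewrite {1}xy.
by apply: nomin; exists y0; split=> // y; exact: lower_bound.
Qed.

Theorem theorem7p7 (X : Type) (f : X -> X) (x0 : X)
    (hI : peano_iterator f x0) :
  exists le : X -> X -> Prop,
    unique (fun le => total_order le /\ compatible f le) le /\
    (* (1) *)
    (forall x, le x0 x /\ strict le x (f x)) /\
    (* (2) *)
    (forall x y, le y x -> le (f y) (f x)) /\
    (* (3) *)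
    (forall x y, (le y (f x) <-> le y x \/ y = f x) /\
                 (strict le y (f x) <-> le y x)) /\
    (* (4) *)
    (initial_segment le x0 = set0 /\
     (forall x, disjoint_union (initial_segment le (f x))
                  (initial_segment le x) [set x]) /\
     (forall x, disjoint_union (initial_segment le (f x))
                  [set x0] (f @` initial_segment le x))) /\
    (* (5) *)
    (forall x, finite (initial_segment le x)) /\
    (* (6) *)
    (forall Y : set X, Y !=set0 ->
       exists x, Y x /\ forall y, Y y -> le x y).
Proof.
exists (reach f); split.
  split; first by split; [exact: reach_total_order hI | exact: reach_next].
  by move=> le [le_order le_f]; exact: reach_unique hI le_order le_f.
split.
  by move=> x; split; [exact: reach_base hI x | exact: strict_reach_next hI x].
split; first by move=> x y; exact: reach_mono.
split.
  move=> x y; split; last exact: strict_reachSr hI x y.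
  exact: reachSr (peano_injective hI).
split.
  split; first exact: initial_segment_base hI.
  split; [exact: initial_segment_next hI | exact: initial_segment_next_image hI].
split; first exact: finite_initial_segment hI.
by move=> Y; exact: reach_min hI.
Qed.
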